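(* Let $n$ be a positive integer. There exists an antipodal $3$-design with $n$ rational points for the Hermite measure $e^{-t^2}dt/\sqrt{\pi}$ on $(-\infty,\infty)$ if and only if $n \notin \{1,2,3,7\}$.
   Context: Let $I\subseteq\mathbb{R}$ be an interval and $w$ a probability density on $I$ with finite moments. An $m$-design with $n$ points for the measure $w(t)\,dt$ on $I$ is a collection of $n$ pairwise distinct points $x_1,\dots,x_n\in I$ such that $\frac{1}{n}\sum_{i=1}^n f(x_i)=\int_I f(t)w(t)\,dt$ for every real polynomial $f$ of degree at most $m$. It is rational if all $x_i\in\mathbb{Q}$, and antipodal if the set $\{x_1,\dots,x_n\}$ coincides with $\{-x_1,\dots,-x_n\}$. The Hermite measure is $w(t)=e^{-t^2}/\sqrt{\pi}$ on $I=(-\infty,\infty)$. *)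

(* Defs.v *)
From mathcomp Require Import all_boot all_order all_algebra.
From mathcomp Require Import all_classical all_reals all_analysis.

Set Implicit Arguments.
Unset Strict Implicit.
Unset Printing Implicit Defensive.

Import Order.TTheory GRing.Theory Num.Theory.

Local Open Scope classical_set_scope.
Local Open Scope ring_scope.

Section Designs.
Context {R : realType}.

(* The design equation lives in \bar R: as the left-hand side is finite, it
   also asserts that the integral of f w over I is finite. *)
Definition is_design (I : interval R) (w : R -> R) (m n : nat)
    (x : 'I_n -> R) : Prop :=
  [/\ injective x,
      forall i, x i \in I
    & forall f : {poly R}, (size f <= m.+1)%N ->
      ((n%:R)^-1 * \sum_(i < n) f.[x i])%:E =
      (\int[lebesgue_measure]_(t in [set` I]) (f.[t] * w t)%:E)%E].

Definition is_rational (n : nat) (x : 'I_n -> R) : Prop :=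
  forall i, exists q : rat, x i = ratr q.

Definition is_antipodal (n : nat) (x : 'I_n -> R) : Prop :=
  range x = range (fun i => - x i).

Definition hermite_weight (t : R) : R := expR (- t ^+ 2) / Num.sqrt pi.

End Designs.

(* Main.v *)
(** The Hermite moments of order 0, 1, 2, 3 are 1, 0, 1/2, 0, so an antipodal
    set of [n] points is a 3-design iff its sum of squares is [n / 2].

    For [n] in {2, 3, 7} the positive points would yield a representation of 7
    as a sum of three rational squares, which descent modulo 8 excludes.
    Conversely, solutions for [n = 4, 5, 6, 11] are given explicitly, and a
    solution for [n] extends to [n + 4] by adding [a, - a, b, - b], where
    [(a, b)] is one of the infinitely many rational points of the unit circle. *)

Require Import Defs.
From mathcomp Require Import all_boot all_order all_algebra.
From mathcomp Require Import all_classical all_reals all_analysis.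
From mathcomp Require Import measurable_realfun zify ring lra.

Import Order.TTheory GRing.Theory Num.Theory.
Import numFieldNormedType.Exports.

Set Implicit Arguments.
Unset Strict Implicit.
Unset Printing Implicit Defensive.

Local Open Scope classical_set_scope.
Local Open Scope ring_scope.

(** * Seven is not a sum of three rational squares *)

Lemma sqrn_mod8 (a : nat) :
  (a ^ 2 %% 8 = if odd a then 1 else if 4 %| a then 0 else 4)%N.
Proof.
rewrite {1 2 3}(divn_eq a 8) -modnXm modnMDl modn_mod oddD oddM andbF addFb.
rewrite dvdn_addr; last by rewrite dvdn_mull.
by move: (a %% 8)%N (ltn_pmod a (isT : 0 < 8)%N); do 8?[case=> //].
Qed.

(** Infinite descent on [d]. Squares are 0, 1 or 4 modulo 8, so the right side is 0, 4 or 7; this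
    forces all four numbers to be even, and halving them gives a smaller solution. *)
Lemma nat_sum3sq_neq7 (d a b c : nat) :
  (0 < d -> a ^ 2 + b ^ 2 + c ^ 2 <> 7 * d ^ 2)%N.
Proof.
elim/ltn_ind: d a b c => d IH a b c d0 e.
have [ed ea eb ec] : [/\ ~~ odd d, ~~ odd a, ~~ odd b & ~~ odd c].
  move: (sqrn_mod8 a) (sqrn_mod8 b) (sqrn_mod8 c) (sqrn_mod8 d) e.
  move: (a ^ 2)%N (b ^ 2)%N (c ^ 2)%N (d ^ 2)%N => A B C D.
  do 4![case: odd; [|case: ifP => _]] => hA hB hC hD e;
    first [by split | by exfalso; lia].
apply: (IH (d./2) _ (a./2) (b./2) (c./2)); [lia|lia|].
move: e; rewrite -(even_halfK ed) -(even_halfK ea) -(even_halfK eb).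
rewrite -(even_halfK ec) !doubleK -!muln2 !expnMn; lia.
Qed.

Lemma rat_sum3sq_neq7 (a b c : rat) : a ^+ 2 + b ^+ 2 + c ^+ 2 <> 7.
Proof.
have sq (z : int) : (absz z ^ 2)%N%:R = z%:Q ^+ 2.
  by rewrite natrX natr_absz intr_norm real_normK ?num_real.
rewrite -[a]divq_num_den -[b]divq_num_den -[c]divq_num_den => e.
apply: (@nat_sum3sq_neq7 (absz (denq a * denq b * denq c))
  (absz (numq a * denq b * denq c)) (absz (numq b * denq a * denq c))
  (absz (numq c * denq a * denq b))).
  by rewrite absz_gt0 !mulf_neq0 ?denq_neq0.
have [ha hb hc] : [/\ (denq a)%:Q != 0, (denq b)%:Q != 0 & (denq c)%:Q != 0].
  by rewrite !intr_eq0 !denq_neq0.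
apply/eqP; rewrite -(eqr_nat rat) 2!natrD (natrM _ 7) !sq -e !intrM; apply/eqP; field; exact/and3P.
Qed.

(** * Finite sets closed under negation *)

Section OppositeClosedLists.
Variables (R : realDomainType) (l : seq R).
Hypotheses (ul : uniq l) (ol : {in l, forall x, - x \in l}).

Let p := [seq x <- l | 0 < x].

(** Splits [l] by sign; the Boolean [0 \in l] serves as the multiplicity of 0. Size and power sums
    are then read off from this decomposition. *)
Lemma opp_closed_perm : perm_eq l (p ++ map -%R p ++ nseq (0 \in l) 0).
Proof.
have up : uniq p by rewrite filter_uniq.
have mpN x : (x \in map -%R p) = (x < 0) && (x \in l).
  rewrite -[x in LHS]opprK mem_map; last exact: oppr_inj.
  rewrite mem_filter oppr_gt0; congr (_ && _).
  by apply/idP/idP => /ol; rewrite ?opprK.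
apply: uniq_perm => // [|x].
  rewrite !cat_uniq up map_inj_uniq ?up; last exact: oppr_inj.
  apply/and3P; split=> //.
    apply/hasPn => x; rewrite mem_cat mpN mem_nseq => xN.
    rewrite /= mem_filter negb_and -leNgt.
    by case/orP: xN => /andP[]; [move=> /ltW -> | move=> _ /eqP ->; rewrite lexx].
  apply/and3P; split=> //; last by case: (0 \in l).
  by apply/hasPn => x; rewrite mem_nseq => /andP[_ /eqP->] /=; rewrite mpN ltxx.
rewrite !mem_cat mpN mem_nseq mem_filter.
case: ltgtP => [x0|x0|<-] /=; rewrite ?andbF ?orbF ?andbT//.
by case: (0 \in l).
Qed.

Lemma opp_closed_size : size l = ((size p).*2 + (0%R \in l))%N.
Proof.
by rewrite (perm_size opp_closed_perm) !size_cat size_map size_nseq addnA addnn.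
Qed.

Lemma opp_closed_sumsq :
  \sum_(x <- l) x ^+ 2 = (\sum_(x <- l | 0 < x) x ^+ 2) *+ 2.
Proof.
rewrite (perm_big _ opp_closed_perm) /= !big_cat /= big_map big_filter.
rewrite big_nseq; under [X in _ + (X + _)]eq_bigr do rewrite sqrrN.
rewrite big_filter expr0n /= mulr2n; case: (0 \in l) => /=; by rewrite !addr0.
Qed.

Lemma opp_closed_sum_odd k : odd k -> \sum_(x <- l) x ^+ k = 0.
Proof.
move=> ok; rewrite (perm_big _ opp_closed_perm) /= !big_cat /= big_map.
rewrite big_nseq; under [X in _ + (X + _)]eq_bigr do rewrite exprNn -signr_odd ok mulN1r.
rewrite sumrN expr0n; case: k ok => //= k _.
by case: (0 \in l) => /=; rewrite ?addr0 subrr.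
Qed.

End OppositeClosedLists.

(** * Rational node lists and the excluded sizes *)

(** Algebraic form of an antipodal rational 3-design: by symmetry the odd power sums vanish, so only
    the second moment remains as a condition. *)
Definition antipodal_nodes (n : nat) (l : seq rat) : Prop :=
  [/\ uniq l, size l = n, {in l, forall x, - x \in l}
    & \sum_(x <- l) x ^+ 2 = n%:R / 2].

Lemma antipodal_nodes_notin n l :
  (0 < n)%N -> antipodal_nodes n l -> n \notin [:: 1; 2; 3; 7]%N.
Proof.
move=> n0 [ul sl ol]; rewrite (opp_closed_sumsq ul ol) -big_filter.
move: (opp_closed_size ul ol); rewrite sl; set p := seq.filter _ _ => sp e.
(* The squares of the doubled positive nodes sum to n. For n = 2 and n = 3 they are completed to 7
   by 4 + 1 and 4 + 0; for n = 1 there is no positive node. *)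
apply/negP; rewrite !inE => /or4P[] /eqP n_eq; rewrite {}n_eq {sl n0 n} in sp e.
- have : size p = 0%N by lia.
  by move/size0nil => p0; move: e; rewrite p0 big_nil; lra.
- have : size p = 1%N by lia.
  case: p {sp} e => [|x [|]]// + _; rewrite big_seq1 => e.
  by apply: (@rat_sum3sq_neq7 (x *+ 2) 2 1); lra.
- have : size p = 1%N by lia.
  case: p {sp} e => [|x [|]]// + _; rewrite big_seq1 => e.
  by apply: (@rat_sum3sq_neq7 (x *+ 2) 2 0); lra.
- have : size p = 3%N by lia.
  case: p {sp} e => [|x [|y [|z [|]]]]// + _; rewrite !big_cons big_nil => e.
  by apply: (@rat_sum3sq_neq7 (x *+ 2) (y *+ 2) (z *+ 2)); lra.
Qed.

(** * Rational points of the unit circle and extension by four nodes *)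

Section CirclePoints.
Variable F : realFieldType.
Implicit Types s t : F.

(** Stereographic projection from (1, 0): the second intersection of the circle with the line
    through (1, 0) and (0, t). *)
Definition circle_x t := (t ^+ 2 - 1) / (t ^+ 2 + 1).
Definition circle_y t := t *+ 2 / (t ^+ 2 + 1).

Let den_gt0 t : 0 < t ^+ 2 + 1.
Proof. by rewrite ltr_wpDl// sqr_ge0. Qed.

Lemma circleP t : circle_x t ^+ 2 + circle_y t ^+ 2 = 1.
Proof. by rewrite /circle_x /circle_y; field; rewrite gt_eqF. Qed.

(** The threshold 12 comes from the last bound, which amounts to 12 t < t^2 + 1. *)
Lemma circle_bounds t : 12 <= t ->
  [/\ 4/5 < circle_x t, circle_x t < 1, 0 < circle_y t & circle_y t < 1/6].
Proof.
move=> t12; have t2 : 12 * t <= t ^+ 2 by rewrite expr2 ler_pM2r//; lra.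
rewrite /circle_x /circle_y.
split; [rewrite ltr_pdivlMr//|rewrite ltr_pdivrMr//
  |rewrite divr_gt0//|rewrite ltr_pdivrMr//]; lra.
Qed.

Lemma circle_mono s t : 12 <= s -> s < t ->
  circle_x s < circle_x t /\ circle_y t < circle_y s.
Proof.
move=> s12 st; rewrite /circle_x /circle_y.
split; rewrite ltr_pdivrMr// mulrAC ltr_pdivlMr//; first by nra.
(* This product is the cross-multiplied difference s (t^2 + 1) - t (s^2 + 1). *)
have : 0 < (t - s) * (s * t - 1) by apply: mulr_gt0; nra.
nra.
Qed.

End CirclePoints.

(* For [k >= 12] the points lie in ]4/5, 1[ x ]0, 1/6[, which avoids every
   coordinate of [base_nodes]. *)
Definition fresh (K : nat) (l : seq rat) : Prop :=
  forall k, (K <= k)%N -> circle_x k%:R \notin l /\ circle_y k%:R \notin l.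

(** The four new squares sum to 2, which is 4 / 2. Later circle points stay fresh because both
    coordinates are strictly monotone in the parameter and the abscissas lie above the ordinates. *)
Lemma antipodal_nodes_add4 n K l :
  (12 <= K)%N -> antipodal_nodes n l -> fresh K l ->
  exists2 l', antipodal_nodes n.+4 l' & fresh K.+1 l'.
Proof.
move=> K12 [ul sl ol e] fl.
pose x : rat := circle_x K%:R; pose y : rat := circle_y K%:R.
have [xl yl] : x \notin l /\ y \notin l := fl K (leqnn K).
have Nl z : (- z \in l) = (z \in l).
  by apply/idP/idP => /ol; rewrite ?opprK.
have K12' : 12 <= K%:R :> rat by rewrite ler_nat.
have [x1 x2 y1 y2] : [/\ 4/5 < x, x < 1, 0 < y & y < 1/6] := circle_bounds K12'.
exists [:: x, - x, y, - y & l].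
  split.
  - rewrite /= !inE !Nl (negPf xl) (negPf yl) ul !orbF !andbT.
    rewrite !negb_or; clear -x1 x2 y1 y2.
    by do !(apply/andP; split); apply/eqP => ?; lra.
  - by rewrite /= sl.
  - move=> z; rewrite !inE.
    by move=> /or4P[/eqP->|/eqP->|/eqP->|/orP[/eqP->|/ol ->]];
      rewrite ?opprK ?eqxx ?orbT.
  - rewrite !big_cons !sqrrN e -[n.+4]addn4 natrD.
    by have : x ^+ 2 + y ^+ 2 = 1 := circleP _; clear; lra.
move=> k Kk; have [xkl ykl] := fl k (ltnW Kk).
have Kk' : K%:R < k%:R :> rat by rewrite ltr_nat.
have [x3 x4 y3 y4] := circle_bounds (le_trans K12' (ltW Kk')).
have [] := circle_mono K12' Kk'; rewrite -/x -/y => hx hy.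
rewrite !inE (negPf xkl) (negPf ykl) !orbF !negb_or.
clear -x1 x2 y1 y2 x3 x4 y3 y4 hx hy.
by split; do !(apply/andP; split); apply/eqP => ?; lra.
Qed.

Lemma antipodal_nodes_add4_iter n l i :
  antipodal_nodes n l -> fresh 12 l -> exists l', antipodal_nodes (i * 4 + n) l'.
Proof.
move=> dl fl.
(* The induction must carry freshness, whose threshold rises by one with each added quadruple. *)
suff [l' []] : exists l', antipodal_nodes (i * 4 + n) l' /\ fresh (12 + i) l'.
  by exists l'.
elim: i => [|i [l' [dl' fl']]]; first by exists l.
have [|l'' d'' f''] := antipodal_nodes_add4 _ dl' fl'; first by rewrite leq_addr.
by exists l''; rewrite addnS.
Qed.

(** Reduces freshness, a statement about all [k], to a test decidable by computation. *)
Lemma fresh_base l :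
  all (fun z : rat => (z <= 0) || (1/6 <= z <= 4/5) || (1 <= z)) l -> fresh 12 l.
Proof.
move=> /allP al k; rewrite -(ler_nat rat) => /circle_bounds[x1 x2 y1 y2].
by split; apply/negP => /al /orP[/orP[|/andP[]]|]; lra.
Qed.

(** * Base solutions and existence for all remaining sizes *)

(** Indexed by n modulo 4. Class 3 starts at 11, since 3 and 7 are impossible; its list is the
    disjoint union of those for 5 and 6. *)
Definition base_nodes (r : nat) : seq rat :=
  match r with
  | 0 => [:: 3/5; 4/5; - (3/5); - (4/5)]
  | 1 => [:: 0; 1/2; 1; - (1/2); - 1]
  | 2 => [:: 7/6; 1/3; 1/6; - (7/6); - (1/3); - (1/6)]
  | _ => [:: 0; 1/6; 1/3; 1/2; 1; 7/6; - (1/6); - (1/3); - (1/2); - 1; - (7/6)]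
  end.

Lemma base_nodesP r : (r < 4)%N ->
  antipodal_nodes (nth 0 [:: 4; 5; 6; 11] r)%N (base_nodes r) /\
  fresh 12 (base_nodes r).
Proof.
case: r => [|[|[|[|//]]]] _; (split; last by apply: fresh_base; vm_compute).
all: split; [by vm_compute | by [] | by apply/allP; vm_compute |].
all: by rewrite !big_cons big_nil [nth _ _ _]/=; lra.
Qed.

Lemma antipodal_nodes_exists n :
  (0 < n)%N -> n \notin [:: 1; 2; 3; 7]%N -> exists l, antipodal_nodes n l.
Proof.
move=> n0 nn; have [l_nodes l_fresh] := base_nodesP (ltn_pmod n (isT : 0 < 4)%N).
have [l hl] := antipodal_nodes_add4_iter
  ((n - nth 0 [:: 4; 5; 6; 11] (n %% 4)) %/ 4)%N l_nodes l_fresh.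
exists l; move: hl; congr antipodal_nodes.
(* The exclusions put [n] at or above the base size of its class, so the truncated subtraction is
   exact. *)
have := ltn_pmod n (isT : 0 < 4)%N; move: nn; rewrite !inE.
by case E : (n %% 4)%N => [|[|[|[|]]]]//= nn _; lia.
Qed.

(** * Integrals of polynomials against the Gaussian *)

Section GaussianMoments.
Context {R : realType}.
Let mu := @lebesgue_measure R.
Implicit Types (p f : {poly R}) (t : R).

(** Horner induction with [a] general: half of the exponent bounds the shorter polynomial, the other
    half absorbs the factor t through |t| <= 1 + t^2 and 1 + u <= exp u. *)
Lemma poly_le_expR_sqr p (a : R) : 0 < a ->
  exists2 C : R, 0 <= C & forall t, `|p.[t]| <= C * expR (a * t ^+ 2).
Proof.
elim/poly_ind: p a => [|p c IH] a a0.
  by exists 0 => // t; rewrite horner0 normr0 mul0r.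
have [C C0 pC] := IH (a / 2) (divr_gt0 a0 (ltr0Sn _ 1)).
exists (C * (1 + 2 / a) + `|c|) => [|t].
  by rewrite addr_ge0// mulr_ge0// addr_ge0// divr_ge0// ltW.
have a1 : 0 <= a * t ^+ 2 by rewrite mulr_ge0// ?sqr_ge0// ltW.
rewrite hornerMXaddC mulrDl (le_trans (ler_normD _ _))// lerD//; last first.
  by rewrite ler_peMr// -expR0 ler_expR.
rewrite normrM [a * _](_ : _ = a / 2 * t ^+ 2 + a / 2 * t ^+ 2); last by field.
rewrite expRD mulrACA ler_pM// (le_trans (_ : _ <= 1 + t ^+ 2))//.
  by rewrite -[t ^+ 2]real_normK ?num_real//; have := normr_ge0 t; nra.
have -> : 1 + t ^+ 2 = 1 + 2 / a * (a / 2 * t ^+ 2) by field; rewrite gt_eqF.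
have E := expR_ge1Dx (a / 2 * t ^+ 2).
have a2 : 0 < 2 / a by rewrite divr_gt0.
have a3 : 0 <= a / 2 * t ^+ 2 by lra.
apply: le_trans (ler_wpM2l _ E); last by lra.
by have := mulr_ge0 (ltW a2) a3; lra.
Qed.

(** Half of the Gaussian decay pays for the polynomial. The remaining half yields both integrability
    and vanishing at infinity. *)
Lemma gauss_poly_bound p : exists2 C : R, 0 <= C &
  forall t, `|p.[t] * gauss_fun t| <= C * expR (- (t ^+ 2 / 2)).
Proof.
have [C C0 pC] := @poly_le_expR_sqr p (1 / 2) ltac:(lra).
exists C => // t; rewrite normrM (ger0_norm (gauss_fun_ge0 t)).
rewrite (le_trans (ler_wpM2r (gauss_fun_ge0 t) (pC t)))// -mulrA.
rewrite /gauss_fun -expRD ler_wpM2l// ler_expR; lra.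
Qed.

Lemma integrable_gauss_half :
  mu.-integrable setT (fun t => (expR (- (t ^+ 2 / 2)))%:E).
Proof.
have := integrable_normal_pdf (0 : R) 1.
move/(integrableZl measurableT (normal_peak (1 : R))^-1).
apply: eq_integrable => //= t _; rewrite normal_pdfE// /normal_fun -EFinM.
rewrite mulKf ?gt_eqF ?normal_peak_gt0//.
by congr ((expR _)%:E); field.
Qed.

Lemma integrable_poly_gauss p :
  mu.-integrable setT (fun t => (p.[t] * gauss_fun t)%:E).
Proof.
have [C C0 pC] := gauss_poly_bound p.
apply: le_integrable (integrableZl _ C integrable_gauss_half) => //=.
  apply/measurable_EFinP; apply: measurable_funM.
    by apply: continuous_measurable_fun; exact: continuous_horner.
  exact: measurable_gauss_fun.
move=> t _; rewrite lee_fin (le_trans (pC t))//.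
by rewrite ler_norm.
Qed.

(** The hypothesis on the square of [u] covers both ends of the line at once. *)
Lemma cvg_poly_gauss p (u : R^nat) : (u n) ^+ 2 @[n --> \oo] --> +oo ->
  p.[u n] * gauss_fun (u n) @[n --> \oo] --> 0.
Proof.
move=> uoo; have [C C0 pC] := gauss_poly_bound p.
apply/norm_cvg0P.
apply: (@squeeze_cvgr _ _ _ _ (fun=> 0) (fun n => C * expR (- ((u n) ^+ 2 / 2)))).
- by near=> n; rewrite normr_ge0 pC.
- exact: cvg_cst.
rewrite -(mulr0 C); apply: cvgMr.
have : (u n) ^+ 2 / 2 @[n --> \oo] --> +oo.
  apply/cvgryPge => A; move/cvgryPge: uoo => /(_ (A * 2)).
  by apply: filterS => n; rewrite ler_pdivlMr.
by move=> h; exact: cvg_comp h (@cvgr_expR R).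
Unshelve. all: by end_near. Qed.

Lemma is_derive_gauss_fun t :
  is_derive t 1 gauss_fun (- (t *+ 2) * gauss_fun t).
Proof.
rewrite (_ : gauss_fun = expR \o (fun t : R => - t ^+ 2))//.
apply: is_derive_eq; rewrite /gauss_fun /GRing.scale /=; ring.
Qed.

Lemma is_derive_poly_gauss p t :
  is_derive t 1 (fun t => p.[t] * gauss_fun t)
    ((p^`() - 'X * p *+ 2).[t] * gauss_fun t).
Proof.
have dp : is_derive t 1 (horner p) p^`().[t].
  by apply: DeriveDef; [exact: derivable_horner|rewrite -derive1E -derivE].
have dg := is_derive_gauss_fun t.
apply: (is_derive_eq (is_deriveM dp dg)).
rewrite !hornerE /GRing.scale /=; ring.
Qed.

(* Integration by parts: the integrand is the derivative of [p.[t] * gauss_fun t]. *)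
Lemma integral_deriv_gauss p :
  (\int[mu]_t ((p^`() - 'X * p *+ 2).[t] * gauss_fun t)%:E = 0)%E.
Proof.
set q := _ - _; pose f t := q.[t] * gauss_fun t.
pose F t := p.[t] * gauss_fun t.
have dF t : is_derive t 1 F (f t) := is_derive_poly_gauss p t.
have cf : continuous f.
  by move=> t; apply: cvgM; [exact: continuous_horner|exact: continuous_gauss_fun].
have cF : continuous F.
  by move=> t; apply: cvgM; [exact: continuous_horner|exact: continuous_gauss_fun].
(* The successor keeps the endpoints distinct even at n = 0. *)
pose I n : set R := `[- n.+1%:R, n.+1%:R]%classic.
have FTC n : (\int[mu]_(t in I n) (f t)%:E = (F n.+1%:R - F (- n.+1%:R))%:E)%E.
  rewrite (@continuous_FTC2 _ f F)//.
  - by rewrite gtrN.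
  - exact: continuous_subspaceT.
  - split=> [t _||].
    + exact: ex_derive.
    + exact/cvg_at_right_filter/cF.
    + exact/cvg_at_left_filter/cF.
  - by move=> t _; rewrite derive1E derive_val.
have F0 : (F n.+1%:R - F (- n.+1%:R)) @[n --> \oo] --> (0 : R).
  have noo : (n.+1%:R : R) ^+ 2 @[n --> \oo] --> +oo.
    apply: (cvg_comp (fun n => n.+1%:R : R) (fun t : R => t ^+ 2)); last exact: cvgr_expr2.
    by rewrite (cvg_shiftS (fun n => n%:R : R)); exact: cvgr_idn.
  rewrite -(subr0 0); apply: cvgB; apply: cvg_poly_gauss => //.
  by under eq_fun do rewrite sqrrN.
have If : mu.-integrable setT (EFin \o f) := integrable_poly_gauss q.
pose f_ n := (EFin \o f) \_ (I n).
have f_E : (fun n => \int[mu]_t f_ n t)%E =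
    (fun n => (F n.+1%:R - F (- n.+1%:R))%:E).
  by apply/funext => n; rewrite -FTC [RHS]integral_mkcond.
have mf : measurable_fun setT (EFin \o f) by case/integrableP: If.
have f0 : (F n.+1%:R - F (- n.+1%:R))%:E @[n --> \oo] --> (0 : R)%:E.
  by apply: cvg_EFin => //; exact: nearW.
(* The integrals over [I n] tend to 0; dominated convergence, with bound |f|, identifies their limit
   with the integral over the line. *)
suff fI : (\int[mu]_t f_ n t @[n --> \oo] --> \int[mu]_t (EFin \o f) t)%E.
  by rewrite f_E in fI; exact: (cvg_unique _ fI f0).
apply: (@dominated_cvg _ _ _ mu setT measurableT f_ (EFin \o f)
  (fun t => `|(f t)%:E|%E)) => //.
- move=> n; have mI : measurable (I n) by exact: measurable_itv.
  by apply: (measurable_restrictT (EFin \o f) mI).1; exact: measurable_funTS.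
- move=> t _; apply: cvg_near_cst.
  exists (Num.truncn `|t|) => // n /= tn.
  rewrite /f_ patchE mem_set// /I /= in_itv /= -ler_norml.
  by rewrite (le_trans (ltW (truncnS_gt _)))// ler_nat.
- exact: integrable_abse.
- by move=> n t _; rewrite /f_ patchE; case: ifP => // _; rewrite abse0.
Qed.

Lemma integral_hermite_cubic f : (size f <= 4)%N ->
  (\int[mu]_t (f.[t] * (gauss_fun t / Num.sqrt pi))%:E = (f`_0 + f`_2 / 2)%:E)%E.
Proof.
move=> sf.
(* Found by solving p' - 2 X p = f - c for a constant c, from the top coefficient down; the
   solvability condition is c = f_0 + f_2 / 2. *)
pose p := - (f`_1 / 2 + f`_3 / 2)%:P - (f`_2 / 2) *: 'X - (f`_3 / 2) *: 'X^2.
have fE : f = (f`_0 + f`_2 / 2)%:P + (p^`() - 'X * p *+ 2).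
  have f4 i : (4 <= i)%N -> f`_i = 0 by move=> i4; rewrite nth_default// (leq_trans sf).
  apply/polyP => i; rewrite /p !coefE.
  case: i => [|[|[|[|i]]]] /=; [by field|by field|by field|by field|].
  by rewrite f4// !mulr0 !(subr0, oppr0, mul0rn, add0r).
have spi : Num.sqrt pi != 0 :> R by rewrite gt_eqF// sqrtr_gt0 pi_gt0.
set c := f`_0 + f`_2 / 2 in fE *.
have E t : (f.[t] * (gauss_fun t / Num.sqrt pi))%:E =
  ((c / Num.sqrt pi)%:E * (gauss_fun t)%:E + (Num.sqrt pi)^-1%:E *
   ((p^`() - 'X * p *+ 2).[t] * gauss_fun t)%:E)%E.
  by rewrite {1}fE hornerD hornerC -!EFinM -EFinD; congr EFin; field.
under eq_integral do rewrite E.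
have i1 := @integrableT_gauss R.
have i2 := integrable_poly_gauss (p^`() - 'X * p *+ 2).
rewrite integralD//; [|exact: integrableZl|exact: integrableZl].
rewrite !integralZl// integralT_gauss integral_deriv_gauss mule0 adde0.
by rewrite -EFinM divfK.
Qed.

End GaussianMoments.

(** * Passage between designs and rational node lists *)

Section DesignNodes.
Context {R : realType}.

Lemma hermite_designP n (x : 'I_n -> R) : injective x ->
  is_design `]-oo, +oo[ hermite_weight 3 x <->
  forall f : {poly R}, (size f <= 4)%N ->
    n%:R^-1 * \sum_(i < n) f.[x i] = f`_0 + f`_2 / 2.
Proof.
have I (f : {poly R}) : (size f <= 4)%N ->
    (\int[lebesgue_measure]_(t in [set` `]-oo, +oo[]) (f.[t] * hermite_weight t)%:E
    = (f`_0 + f`_2 / 2)%:E)%E.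
  by move=> sf; rewrite set_itvNyy; exact: integral_hermite_cubic.
move=> xI; split=> [[_ _ H] f sf|H].
  by apply/EFin_inj; rewrite -I//; exact: H.
by split=> // f sf; rewrite I// H.
Qed.

Lemma design_antipodal_nodes n (x : 'I_n -> R) : (0 < n)%N ->
  is_design `]-oo, +oo[ hermite_weight 3 x -> is_rational x ->
  is_antipodal x -> exists l, antipodal_nodes n l.
Proof.
move=> n0 dx /choice[q xq] ax; have [xI _ _] := dx.
have qI : injective q by move=> i j ij; apply: xI; rewrite !xq ij.
exists [seq q i | i <- enum 'I_n]; split.
- by rewrite map_inj_uniq// enum_uniq.
- by rewrite size_map size_enum_ord.
- move=> _ /mapP[i _ ->].
  have [j _ xj] : range x (- x i) by rewrite ax; exists i.
  suff -> : - q i = q j by rewrite map_f// mem_enum.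
  by apply: (fmorph_inj (@ratr R)); rewrite rmorphN /= -!xq xj.
(* Testing the design on X^2 gives the sum of squares, pulled back to the rationals by injectivity
   of [ratr]. *)
- have := (hermite_designP xI).1 dx 'X^2; rewrite size_polyXn => /(_ isT).
  rewrite !coefXn /= add0r => e; apply: (fmorph_inj (@ratr R)).
  have n0R : n%:R != 0 :> R by rewrite pnatr_eq0 -lt0n.
  rewrite big_map big_enum /= rmorph_sum fmorph_div /= !ratr_nat -[RHS]mulrC.
  rewrite -[2^-1]mul1r -e mulrC mulVKf//.
  by apply: eq_bigr => i _; rewrite hornerXn xq rmorphXn.
Qed.

Lemma antipodal_nodes_design n l : (0 < n)%N -> antipodal_nodes n l ->
  exists x : 'I_n -> R, [/\ is_design `]-oo, +oo[ hermite_weight 3 x,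
    is_rational x & is_antipodal x].
Proof.
move=> n0 [ul sl ol e]; pose x (i : 'I_n) : R := ratr l`_i.
have il (i : 'I_n) : (i < size l)%N by rewrite sl.
have xI : injective x.
  move=> i j /fmorph_inj /eqP; rewrite nth_uniq// => /eqP; exact: val_inj.
have xN i : exists j, x j = - x i.
  have lj := ol _ (mem_nth 0 (il i)).
  have jn : (index (- l`_i) l < n)%N by rewrite -[X in (_ < X)%N]sl index_mem.
  by exists (Ordinal jn); rewrite /x /= nth_index// rmorphN.
exists x; split; [|by move=> i; exists l`_i|].
- apply/(hermite_designP xI) => f sf.
  have S k : \sum_(i < n) x i ^+ k = ratr (\sum_(y <- l) y ^+ k).
    rewrite (big_nth 0) big_mkord sl rmorph_sum /=.
    by apply: eq_bigr => i _; rewrite rmorphXn.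
  (* Expanding [f] in monomials leaves the power sums of orders 0 to 3, which are n, 0, n / 2 and
     0. *)
  under eq_bigr do rewrite (horner_coef_wide _ sf).
  rewrite exchange_big /=; under eq_bigr do rewrite -mulr_sumr S.
  rewrite !big_ord_recl big_ord0 /= /bump /= !add1n.
  rewrite e (opp_closed_sum_odd ul ol (_ : odd 1))//
    (opp_closed_sum_odd ul ol (_ : odd 3))// rmorph0 fmorph_div /= !ratr_nat.
  rewrite (eq_bigr (fun=> 1)) => [|? _]; last by rewrite expr0.
  rewrite big_const_seq count_predT iter_addr_0 sl ratr_nat.
  by field; rewrite pnatr_eq0 -lt0n.
- apply/seteqP; split=> _ [i _ <-]; have [j xj] := xN i.
  + by exists j => //; rewrite xj opprK.
  + by exists j.
Qed.

End DesignNodes.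

Theorem theorem1p1 (R : realType) (n : nat) (hn : (0 < n)%N) :
  (exists x : 'I_n -> R,
     [/\ is_design `]-oo, +oo[ hermite_weight 3 x,
         is_rational x
       & is_antipodal x])
  <-> n \notin [:: 1; 2; 3; 7]%N.
Proof.
split=> [[x [dx rx ax]]|nn].
  have [l hl] := design_antipodal_nodes hn dx rx ax.
  exact: antipodal_nodes_notin hl.
have [l hl] := antipodal_nodes_exists hn nn.
exact: antipodal_nodes_design hl.
Qed.
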